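(* There do not exist a real number $z_0>0$, an integer $r\in\mathbb{N}=\{0,1,2,\dots\}$ and a continuous map $H:[0,z_0]\to\mathcal{M}_r(\mathbb{R})$ such that for any $z\in[0,z_0]$ the matrix $H(z)$ is symmetric and has the following property: for every real sequence $\boldsymbol{\Phi}=(\Phi_j)_{j\le 2}\in\ell^2(-\infty,2)$ satisfying the second order extrapolation boundary conditions $\Delta\Phi_1=\Delta\Phi_0=0$, with the sequence $\boldsymbol{\Psi}=(\Psi_j)_{j\le 0}$ defined by $$\forall\, j\le 0,\quad \Psi_j:=\Phi_j-z\,D_0\Phi_j+\frac{z^2}{2}\,\Delta\Phi_j+\frac{z(1-z^2)}{6}\,D_0\Delta\Phi_j-\frac{z^2(1-z^2)}{24}\,\Delta^2\Phi_j ,$$ the following energy inequality holds: $$\sum_{j\le -r}\Psi_j^2+\begin{pmatrix}\Psi_{-r+1}\\ \vdots\\ \Psi_0\end{pmatrix}^T H(z)\begin{pmatrix}\Psi_{-r+1}\\ \vdots\\ \Psi_0\end{pmatrix}-\sum_{j\le -r}\Phi_j^2-\begin{pmatrix}\Phi_{-r+1}\\ \vdots\\ \Phi_0\end{pmatrix}^T H(z)\begin{pmatrix}\Phi_{-r+1}\\ \vdots\\ \Phi_0\end{pmatrix}\le 0 .$$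
   Context: $\ell^2(-\infty,2)$ denotes the space of real square-summable sequences indexed by the integers $j\le 2$. $\mathcal{M}_r(\mathbb{R})$ is the space of real $r\times r$ matrices; when $r=0$ the quadratic terms involving $H(z)$ are absent. The difference operators are $$D_0\Phi_j:=\tfrac12(\Phi_{j+1}-\Phi_{j-1}),\qquad \Delta\Phi_j:=\Phi_{j-1}-2\Phi_j+\Phi_{j+1},$$ $$D_0\Delta\Phi_j=\tfrac12(-\Phi_{j-2}+2\Phi_{j-1}-2\Phi_{j+1}+\Phi_{j+2}),\qquad \Delta^2\Phi_j=\Phi_{j-2}-4\Phi_{j-1}+6\Phi_j-4\Phi_{j+1}+\Phi_{j+2}.$$ No positivity of $H(z)$ is assumed. *)

(* Defs.v *)
From mathcomp Require Export all_boot all_order all_algebra.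
From mathcomp Require Import ring.
From mathcomp Require Export all_classical all_reals all_analysis.

Set Implicit Arguments.
Unset Strict Implicit.
Unset Printing Implicit Defensive.

Import Order.TTheory GRing.Theory Num.Theory.
Export numFieldNormedType.Exports.

Local Open Scope classical_set_scope.
Local Open Scope ring_scope.

(* A real sequence indexed by the integers j <= m is represented by a total
   function u : int -> R whose values at j > m are irrelevant: they are neither
   constrained nor read by the norms, boundary vectors and schemes below. *)

Section difference_operators.
Variable R : realType.
Implicit Types (u : int -> R) (j : int).

Definition D0 u : int -> R := fun j => 2^-1 * (u (j + 1) - u (j - 1)).

Definition Delta u : int -> R := fun j => u (j - 1) - 2 * u j + u (j + 1).

Lemma D0_DeltaE u j : D0 (Delta u) j =
  2^-1 * (- u (j - 2) + 2 * u (j - 1) - 2 * u (j + 1) + u (j + 2)).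
Proof.
rewrite /D0 /Delta.
have -> : j + 1 - 1 = j by ring.
have -> : j - 1 + 1 = j by ring.
have -> : j + 1 + 1 = j + 2 by ring.
have -> : j - 1 - 1 = j - 2 by ring.
by field.
Qed.

Lemma Delta_DeltaE u j : Delta (Delta u) j =
  u (j - 2) - 4 * u (j - 1) + 6 * u j - 4 * u (j + 1) + u (j + 2).
Proof.
rewrite /Delta.
have -> : j + 1 - 1 = j by ring.
have -> : j - 1 + 1 = j by ring.
have -> : j + 1 + 1 = j + 2 by ring.
have -> : j - 1 - 1 = j - 2 by ring.
by ring.
Qed.

(* The value at j only involves u (j - 2), ..., u (j + 2), so for j <= 0 it
   only depends on the entries of u with index at most 2. *)
Definition scheme (z : R) u : int -> R := fun j =>
  u j - z * D0 u j + z ^+ 2 / 2 * Delta u j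
  + z * (1 - z ^+ 2) / 6 * D0 (Delta u) j
  - z ^+ 2 * (1 - z ^+ 2) / 24 * Delta (Delta u) j.

End difference_operators.

Section energy.
Variable R : realType.
Implicit Types (u : int -> R) (m : int).

(* Squared l^2 norm over the integers j <= m, with value +oo when the entries
   are not square summable. *)
Definition sqnorm_upto m u : \bar R :=
  (\esum_(j in [set j : int | (j <= m)%R]) (u j ^+ 2)%:E)%E.

Definition ell2_upto m u : Prop := (sqnorm_upto m u < +oo)%E.

(* The column vector (u (-r+1), ..., u 0); entry i : 'I_r is numbered from 0. *)
Definition boundary_vec (r : nat) u : 'cV[R]_r :=
  \col_(i < r) u (- r%:Z + 1 + i%:Z).

(* For r = 0 this is 0, the matrix product being an empty sum. *)
Definition quad_form (r : nat) (A : 'M[R]_r) (v : 'cV[R]_r) : R :=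
  (v^T *m A *m v) ord0 ord0.

End energy.

(* Main.v *)
Require Import Defs.
From mathcomp Require Import ring lra zify.
Set Implicit Arguments.
Unset Strict Implicit.
Unset Printing Implicit Defensive.
Import Order.TTheory GRing.Theory Num.Theory.
Local Open Scope classical_set_scope.
Local Open Scope ring_scope.

(** The scheme is the identity at z = 0 and equals u + z * adv u at first order,
    where adv = - D0 + D0 Delta / 6 is the fourth order centered approximation
    of - d/dx, which is skew-symmetric. Applying the energy inequality to a
    fixed finitely supported u, dividing by z > 0 and letting z tend to 0, which
    is where the continuity of H at 0 enters, gives
      \sum_(j <= -r) u_j (adv u)_j + U^T H(0) adv U <= 0                   (E)
    with U the vector of the entries -r+1, ..., 0 of u. So it is enough to see
    that (E) has no symmetric solution H(0), whatever r is.

    Since adv is skew-symmetric, the left-hand side of (E) only involves the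
    entries -r-1, ..., 0 of u and, if r >= 1, the square of the entry of index
    -r-1 is absent. A nonpositive quadratic form in which the square of a
    variable is absent has no cross term with this variable. The cross terms
    with u_(-r-1) have two origins: the interior flux contributes
    u_(-r-1) u_(-r+1) / 12 and, as (adv u)_(-r+1) contains - u_(-r-1) / 12, the
    matrix contributes - u_(-r-1) / 12 times the product of U with the column of
    H(0) attached to the index -r+1. Their cancellation forces this column to be
    the first vector of the canonical basis (dissipative_last_col). Then H(0) is
    block diagonal with blocks 1 and H', and the left-hand side of (E) for H(0)
    and r is the one for H' and r - 1 (corner_dissipative). By induction one is
    left with r = 0, where the extrapolation u_1 = 2 u_0 - u_(-1),
    u_2 = 3 u_0 - 2 u_(-1) turns the left-hand side of (E) into
      (- 13 u_0^2 + 8 u_0 u_(-1) - u_(-1)^2) / 12,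
    which is positive at u_0 = 1, u_(-1) = 4 (not_dissipative). *)

(** * The scheme as a perturbation of the identity *)

Section rate.
Variable R : realType.
Implicit Types (u : int -> R) (z : R) (j : int).

Definition rate z u j : R :=
  - D0 u j + z / 2 * Delta u j + (1 - z ^+ 2) / 6 * D0 (Delta u) j
  - z * (1 - z ^+ 2) / 24 * Delta (Delta u) j.

Lemma scheme_rate z u j : scheme z u j = u j + z * rate z u j.
Proof. by rewrite /scheme /rate; field. Qed.

Definition adv u j : R :=
  12^-1 * (8 * u (j - 1) - u (j - 2) - 8 * u (j + 1) + u (j + 2)).

Lemma rate0 u j : rate 0 u j = adv u j.
Proof. by rewrite /rate D0_DeltaE Delta_DeltaE /D0 /adv; field. Qed.

(** The stencil has width two, hence the images of finitely supported sequences
    are finitely supported. *)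
Lemma rate_eq0 z u j : u (j - 2) = 0 -> u (j - 1) = 0 -> u j = 0 ->
  u (j + 1) = 0 -> u (j + 2) = 0 -> rate z u j = 0.
Proof.
move=> u1 u2 u3 u4 u5.
by rewrite /rate D0_DeltaE Delta_DeltaE /D0 /Delta u1 u2 u3 u4 u5; field.
Qed.

Lemma cvg_rate u j : rate z u j @[z --> 0^'+] --> adv u j.
Proof.
rewrite -rate0; apply: cvg_at_right_filter; rewrite /rate.
move: (D0 u j) (Delta u j) (D0 (Delta u) j) (Delta (Delta u) j) => p q s t.
have cz : (fun z : R => z) z @[z --> 0] --> (0 : R) by exact: cvg_id.
have cz2 : (1 - z ^+ 2) @[z --> (0 : R)] --> (1 - 0 ^+ 2 : R).
  by apply: cvgB; [exact: cvg_cst|exact: (cvgM cz cz)].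
have cc (c : R) : c @[z --> (0 : R)] --> c by exact: cvg_cst.
have czq : z / 2 * q @[z --> (0 : R)] --> 0 / 2 * q.
  by apply: cvgM => //; exact: cvgM.
have czs : (1 - z ^+ 2) / 6 * s @[z --> (0 : R)] --> (1 - 0 ^+ 2) / 6 * s.
  by apply: cvgM => //; exact: cvgM.
have czt : z * (1 - z ^+ 2) / 24 * t @[z --> (0 : R)] --> 0 * (1 - 0 ^+ 2) / 24 * t.
  by apply: cvgM => //; apply: cvgM => //; exact: cvgM.
exact: (cvgB (cvgD (cvgD (cc (- p)) czq) czs) czt).
Qed.

End rate.

(** * Sequences satisfying the extrapolation condition *)

Section extrapolation.
Variable R : realType.
Implicit Types (a b : nat -> R) (j : int).

(** The entry a n sits at the index - n. On the right of 0 the sequence is the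
    affine one through a 1 and a 0, so that both extrapolation conditions hold. *)
Definition extrap a j : R :=
  match j with
  | Posz n => a 0%N *+ n.+1 - a 1%N *+ n
  | Negz n => a n.+1
  end.

Lemma extrapN a n : extrap a (- n%:Z) = a n.
Proof. by case: n => [|n] //=; rewrite mulr1n mulr0n subr0. Qed.

Lemma Delta_extrap1 a : Delta (extrap a) 1 = 0.
Proof.
change (extrap a 0%N - 2 * extrap a 1%N + extrap a 2%N = 0).
by rewrite /=; ring.
Qed.

Lemma Delta_extrap0 a : Delta (extrap a) 0 = 0.
Proof.
change (extrap a (Negz 0) - 2 * extrap a 0%N + extrap a 1%N = 0).
by rewrite /=; ring.
Qed.

Lemma extrap_lin a b t j :
  extrap (fun n => a n + t * b n) j = extrap a j + t * extrap b j.
Proof.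
case: j => [n|n] //=.
by rewrite !mulrnDl -!mulrnAr opprD addrACA -mulrBr.
Qed.

Lemma adv_extrap_lin a b t j :
  adv (extrap (fun n => a n + t * b n)) j
  = adv (extrap a) j + t * adv (extrap b) j.
Proof. by rewrite /adv !extrap_lin; ring. Qed.

Lemma adv_extrap0 a :
  adv (extrap a) 0 = 12^-1 * (14 * a 1%N - a 2%N - 13 * a 0%N).
Proof.
transitivity (12^-1 * (8 * extrap a (Negz 0) - extrap a (Negz 1)
  - 8 * extrap a 1%N + extrap a 2%N)); first by [].
by rewrite /=; ring.
Qed.

Lemma adv_extrapN1 a :
  adv (extrap a) (- 1) = 12^-1 * (8 * a 2%N - a 3%N - 6 * a 0%N - a 1%N).
Proof.
transitivity (12^-1 * (8 * extrap a (Negz 1) - extrap a (Negz 2)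
  - 8 * extrap a 0%N + extrap a 1%N)); first by [].
by rewrite /=; ring.
Qed.

Definition unit_seq (m n : nat) : R := (n == m)%:R.

Lemma extrap_unit m j : (1 < m)%N -> extrap (unit_seq m) j = (j == - m%:Z)%:R.
Proof.
case: m => [|[|m]] // _; case: j => [n|n] /=; first by rewrite !mul0rn subr0.
by rewrite /unit_seq; congr (_%:R); lia.
Qed.

(** Seen from the indices - m, ..., 0, the sequence supported at - m - 2 is
    only reached by the leftmost point of the stencil, at - m. *)
Lemma adv_unit_inner m k : (k <= m)%N ->
  adv (extrap (unit_seq m.+2)) (- k%:Z) = - (k == m)%:R / 12.
Proof.
move=> km; rewrite /adv !extrap_unit //.
have -> : (- k%:Z - 1 == - m.+2%:Z) = false by lia.
have -> : (- k%:Z - 2 == - m.+2%:Z) = (k == m) by lia.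
have -> : (- k%:Z + 1 == - m.+2%:Z) = false by lia.
have -> : (- k%:Z + 2 == - m.+2%:Z) = false by lia.
by rewrite /=; ring.
Qed.

(** The symmetric situation: at - m - 2 the rightmost point of the stencil is
    - m. This and the previous value are opposite, because adv is skew. *)
Lemma adv_unit_outer m i : (i <= m)%N ->
  adv (extrap (unit_seq i)) (- m.+2%:Z) = (i == m)%:R / 12.
Proof.
move=> im; rewrite /adv.
have -> : - m.+2%:Z - 1 = - m.+3%:Z by lia.
have -> : - m.+2%:Z - 2 = - m.+4%:Z by lia.
have -> : - m.+2%:Z + 1 = - m.+1%:Z by lia.
have -> : - m.+2%:Z + 2 = - m%:Z by lia.
rewrite !extrapN /unit_seq.
have -> : (m.+3 == i) = false by lia.
have -> : (m.+4 == i) = false by lia.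
have -> : (m.+1 == i) = false by lia.
by rewrite eq_sym /=; ring.
Qed.

Lemma adv_unit_diag m : adv (extrap (unit_seq m.+2)) (- m.+2%:Z) = 0.
Proof.
rewrite /adv !extrap_unit //.
have -> : (- m.+2%:Z - 1 == - m.+2%:Z) = false by lia.
have -> : (- m.+2%:Z - 2 == - m.+2%:Z) = false by lia.
have -> : (- m.+2%:Z + 1 == - m.+2%:Z) = false by lia.
have -> : (- m.+2%:Z + 2 == - m.+2%:Z) = false by lia.
by rewrite /=; ring.
Qed.

End extrapolation.

(** * No symmetric matrix makes the limit problem dissipative *)

Section dissipativity.
Variable R : realType.
Implicit Types (a b : nat -> R).

(** The bilinear form whose diagonal is the left-hand side of (E). The matrix is
    indexed from the boundary inwards, its row i being attached to the index
    - i: removing the index farthest from the boundary is then removing the last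
    row and column. The sum over j <= - r is cut after N terms. *)
Definition half_energy_rate r (A : 'M[R]_r) N a b : R :=
  \sum_(n < N) a (r + n)%N * adv (extrap b) (- (r + n)%N%:Z)
  + \sum_(i < r) \sum_(k < r) A i k * a i * adv (extrap b) (- k%:Z).

Definition dissipative r (A : 'M[R]_r) := forall a N,
  (forall n, (N <= n)%N -> a n = 0) -> half_energy_rate A N a a <= 0.

Lemma half_energy_rate_linl r (A : 'M[R]_r) N a a' b t :
  half_energy_rate A N (fun n => a n + t * a' n) b
  = half_energy_rate A N a b + t * half_energy_rate A N a' b.
Proof.
rewrite /half_energy_rate mulrDr addrACA; congr (_ + _).
  by rewrite mulr_sumr -big_split /=; apply: eq_bigr => i _; ring.
rewrite mulr_sumr -big_split /=; apply: eq_bigr => i _.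
by rewrite mulr_sumr -big_split /=; apply: eq_bigr => k _; ring.
Qed.

Lemma half_energy_rate_linr r (A : 'M[R]_r) N a b b' t :
  half_energy_rate A N a (fun n => b n + t * b' n)
  = half_energy_rate A N a b + t * half_energy_rate A N a b'.
Proof.
rewrite /half_energy_rate mulrDr addrACA; congr (_ + _).
  rewrite mulr_sumr -big_split /=; apply: eq_bigr => i _.
  by rewrite adv_extrap_lin; ring.
rewrite mulr_sumr -big_split /=; apply: eq_bigr => i _.
rewrite mulr_sumr -big_split /=; apply: eq_bigr => k _.
by rewrite adv_extrap_lin; ring.
Qed.

Lemma affine_le0 (c d : R) : (forall t, c + t * d <= 0) -> d = 0.
Proof.
move=> H; apply: contrapT => /eqP d0.
by have := H ((1 - c) / d); rewrite divfK //; lra.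
Qed.

(** Among the indices j <= 0, let x be supported at the index - i of the boundary
    block - r, ..., 0 and y at - r - 2, two steps to the left of this block.
    The form vanishes at (y, y), so that its value at x + t y is affine in t and
    its slope must be zero. The slope is ((i == ord_max)%:R - A i ord_max) / 12:
    the first term is the interior flux, the second one comes from A. *)
Lemma dissipative_last_col r (A : 'M[R]_r.+1) i :
  dissipative A -> A i ord_max = (i == ord_max)%:R.
Proof.
move=> dA; set N := r.+3.
have ir : (i <= r)%N by rewrite -ltnS.
pose x := @unit_seq R i; pose y := @unit_seq R r.+2.
have Dxy : half_energy_rate A N x y = - A i ord_max / 12.
  rewrite /half_energy_rate big1 ?add0r => [|n _]; last first.
    by rewrite /x /unit_seq (_ : _ == _ = false) ?mul0r //; lia.
  rewrite (bigD1 i) //= [X in _ + X]big1 ?addr0 => [|i' ii']; last first.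
    rewrite big1 // => k _; rewrite /x /unit_seq.
    by rewrite (negbTE (ii' : i' != i :> nat)) mulr0 mul0r.
  rewrite (bigD1 ord_max) //= big1 ?addr0 => [|k kr]; last first.
    rewrite adv_unit_inner ?leq_ord // (negbTE (kr : k != r :> nat)).
    by rewrite oppr0 mul0r mulr0.
  by rewrite adv_unit_inner // /x /unit_seq !eqxx mulr1 mulrA mulrN1.
have Syb b : half_energy_rate A N y b = adv (extrap b) (- r.+2%:Z).
  have r3 : (1 < N)%N by [].
  rewrite /half_energy_rate (bigD1 (Ordinal r3)) //= addn1 /y /unit_seq eqxx mul1r.
  rewrite [X in _ + X + _]big1 ?addr0 => [|n nr]; last first.
    by rewrite (_ : _ == _ = false) ?mul0r //; move: nr; rewrite -val_eqE /=; lia.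
  rewrite big1 ?addr0 // => k _; rewrite big1 // => l _.
  by rewrite (_ : _ == _ = false) ?mulr0 ?mul0r //; have := ltn_ord k; lia.
have Dyx : half_energy_rate A N y x = (i == r :> nat)%:R / 12.
  by rewrite Syb adv_unit_outer.
have Dyy : half_energy_rate A N y y = 0 by rewrite Syb adv_unit_diag.
have : - A i ord_max / 12 + (i == r :> nat)%:R / 12 = 0.
  apply: (@affine_le0 (half_energy_rate A N x x)) => t.
  have := dA (fun n => x n + t * y n) N.
  rewrite half_energy_rate_linl !half_energy_rate_linr.
  rewrite Dxy Dyx Dyy => H.
  apply: le_trans (H _) => [|n Nn].
    by rewrite le_eqVlt; apply/orP; left; apply/eqP; ring.
  rewrite /x /y /unit_seq (_ : n == i = false); last by lia.
  by rewrite (_ : n == r.+2 = false) ?mulr0 ?addr0 //; lia.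
by rewrite -val_eqE /=; lra.
Qed.

Definition corner r (A : 'M[R]_r.+1) : 'M[R]_r :=
  \matrix_(i, k) A (widen_ord (leqnSn r) i) (widen_ord (leqnSn r) k).

(** With a last row and column equal to those of the identity, the index - r is
    weighted like an interior one, so A and its corner define the same form. *)
Lemma corner_dissipative r (A : 'M[R]_r.+1) :
  A^T = A -> dissipative A -> dissipative (corner A).
Proof.
move=> symA dA a N aN; apply: le_trans (dA a N aN).
rewrite /half_energy_rate big_ord_recr /=.
have AE i := dissipative_last_col i dA.
have wE (i : 'I_r) : (widen_ord (leqnSn r) i == ord_max) = false.
  by rewrite -val_eqE /= ltn_eqF.
have rowE : \sum_(k < r.+1) A ord_max k * a r * adv (extrap a) (- k%:Z)
   = a r * adv (extrap a) (- r%:Z).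
  rewrite big_ord_recr /= AE eqxx mul1r big1 ?add0r // => k _.
  by rewrite -symA mxE AE wE !mul0r.
rewrite rowE.
have -> : \sum_(i < r) \sum_(k < r.+1) A (widen_ord (leqnSn r) i) k * a i *
      adv (extrap a) (- k%:Z)
   = \sum_(i < r) \sum_(k < r) corner A i k * a i * adv (extrap a) (- k%:Z).
  apply: eq_bigr => i _; rewrite big_ord_recr /= AE wE !mul0r addr0.
  by apply: eq_bigr => k _; rewrite mxE.
have shift : \sum_(n < N) a (r + n)%N * adv (extrap a) (- (r + n)%N%:Z)
  = a r * adv (extrap a) (- r%:Z)
    + \sum_(n < N) a (r.+1 + n)%N * adv (extrap a) (- (r.+1 + n)%N%:Z).
  (* Moving the cut from N to N.+1 only adds a zero term. *)
  transitivity (\sum_(n < N.+1) a (r + n)%N * adv (extrap a) (- (r + n)%N%:Z)).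
    by rewrite big_ord_recr /= aN ?leq_addl // mul0r addr0.
  by rewrite big_ord_recl /= addn0; congr (_ + _); apply: eq_bigr => n _;
    rewrite /bump /= add1n addnS addSn.
by rewrite shift le_eqVlt; apply/orP; left; apply/eqP; ring.
Qed.

Lemma not_dissipative r (A : 'M[R]_r) : A^T = A -> ~ dissipative A.
Proof.
elim: r A => [|r IH] A symA dA; last first.
  apply: (IH (corner A)); last exact: corner_dissipative.
  by apply/matrixP => i k; rewrite !mxE -[in LHS]symA mxE.
(* The maximum of - 13 + 8 s - s^2 is 3, reached at s = 4. *)
pose a n : R := unit_seq R 0 n + 4 * unit_seq R 1 n.
have aN n : (2 <= n)%N -> a n = 0.
  by case: n => [|[|n]] // _; rewrite /a /unit_seq mulr0 addr0.
have := dA a 2%N aN.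
rewrite /half_energy_rate big_ord0 addr0 !big_ord_recr big_ord0 /= add0r.
rewrite adv_extrap0 adv_extrapN1 (aN 2%N) // (aN 3%N) // /a /unit_seq /=; lra.
Qed.

End dissipativity.

(** * Finitely supported sequences *)

Section finite_support.
Variable R : realType.
Implicit Types (u : int -> R).

Lemma sqnorm_upto_fin m u N : (forall n, (N <= n)%N -> u (m - n%:Z) = 0) ->
  sqnorm_upto m u = (\sum_(n < N) u (m - n%:Z) ^+ 2)%:E.
Proof.
move=> uN; rewrite /sqnorm_upto.
rewrite (@reindex_esum _ _ _ [set: nat] _ (fun n : nat => m - n%:Z)); last first.
  split; first by move=> n _ /=; lia.
  - by move=> n n' _ _ /=; lia.
  - by move=> j /= jm; exists `|m - j|%N => //; lia.
have pos n : (0 <= (u (m - n%:Z) ^+ 2)%:E :> \bar R)%E by rewrite lee_fin sqr_ge0.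
rewrite -nneseries_esumT // (@nneseries_split _ _ 0 N) // add0n.
rewrite eseries0 ?adde0 => [|n Nn _]; last by rewrite uN // expr0n.
by rewrite sumEFin big_mkord.
Qed.

End finite_support.

(** * Letting the CFL number tend to zero *)

Section small_time_step.
Variable R : realType.
Implicit Types (z : R) (u : int -> R).

Lemma quad_formE r (A : 'M[R]_r) v :
  quad_form A v = \sum_(p < r) \sum_(q < r) A p q * v p ord0 * v q ord0.
Proof.
rewrite /quad_form -mulmxA mxE; apply: eq_bigr => p _.
rewrite !mxE big_distrr /=; apply: eq_bigr => q _; ring.
Qed.

(** The variation of the energy in one time step, divided by z; the quotient is
    written as a polynomial in z and rate z u, so that it makes sense and is
    continuous at z = 0. *)
Definition energy_quotient r (A : 'M[R]_r) M z u : R :=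
  let w := rate z u in
  \sum_(n < M) w (- r%:Z - n%:Z) * (2 * u (- r%:Z - n%:Z) + z * w (- r%:Z - n%:Z))
  + \sum_(p < r) \sum_(q < r) A p q *
      let i := - r%:Z + 1 + p%:Z in let k := - r%:Z + 1 + q%:Z in
      (w i * u k + u i * w k + z * (w i * w k)).

Lemma energy_quotientE r (A : 'M[R]_r) M z u :
  \sum_(n < M) scheme z u (- r%:Z - n%:Z) ^+ 2
  + quad_form A (boundary_vec r (scheme z u))
  - \sum_(n < M) u (- r%:Z - n%:Z) ^+ 2 - quad_form A (boundary_vec r u)
  = z * energy_quotient A M z u.
Proof.
rewrite !quad_formE /energy_quotient mulrDr -[LHS]addrA addrACA; congr (_ + _).
  rewrite -sumrB mulr_sumr; apply: eq_bigr => n _.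
  by rewrite scheme_rate; ring.
rewrite -sumrB mulr_sumr; apply: eq_bigr => p _.
rewrite -sumrB mulr_sumr; apply: eq_bigr => q _.
by rewrite !mxE !scheme_rate; ring.
Qed.

Lemma scheme_fin_support z u N : (forall n, (N <= n)%N -> u (- n%:Z) = 0) ->
  forall n, (N.+2 <= n)%N -> scheme z u (- n%:Z) = 0.
Proof.
move=> uN [|[|n]] // Nn; rewrite scheme_rate uN ?rate_eq0 ?mulr0 ?addr0 //.
- by rewrite (_ : _ - _ = - n.+4%:Z) ?uN //; lia.
- by rewrite (_ : _ - _ = - n.+3%:Z) ?uN //; lia.
- by rewrite uN //; lia.
- by rewrite (_ : _ + _ = - n.+1%:Z) ?uN //; lia.
- by rewrite (_ : _ + _ = - n%:Z) ?uN //; lia.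
- by lia.
Qed.

Lemma cvg_sum_ord (T : Type) (F : set_system T) (FF : Filter F) n
  (f : 'I_n -> T -> R) (l : 'I_n -> R) : (forall i, f i @ F --> l i) ->
  (fun x => \sum_(i < n) f i x) @ F --> \sum_(i < n) l i.
Proof.
elim: n f l => [|n IH] f l fl.
  rewrite big_ord0; under eq_fun do rewrite big_ord0; exact: cvg_cst.
rewrite big_ord_recl; under eq_fun do rewrite big_ord_recl.
by apply: cvgD; [exact: fl|apply: IH => i; exact: fl].
Qed.

Lemma cvg_energy_quotient r (A : R -> 'M[R]_r) M u :
  (forall p q, A z p q @[z --> 0^'+] --> A 0 p q) ->
  energy_quotient (A z) M z u @[z --> 0^'+] --> energy_quotient (A 0) M 0 u.
Proof.
move=> cA; rewrite /energy_quotient.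
have cw j : rate z u j @[z --> 0^'+] --> rate 0 u j.
  by rewrite rate0; exact: cvg_rate.
have cz : z @[z --> (0 : R)^'+] --> (0 : R).
  by apply: cvg_at_right_filter; exact: cvg_id.
apply: cvgD.
  apply: cvg_sum_ord => n; apply: cvgM; first exact: cw.
  by apply: cvgD; [exact: cvg_cst|apply: cvgM].
apply: cvg_sum_ord => p; apply: cvg_sum_ord => q; apply: cvgM; first exact: cA.
have cc (c : R) : c @[z --> (0 : R)^'+] --> c by exact: cvg_cst.
exact: (cvgD (cvgD (cvgM (cw _) (cc _)) (cvgM (cc _) (cw _)))
  (cvgM cz (cvgM (cw _) (cw _)))).
Qed.

(** Passes from boundary vectors listed from left to right to the numbering of
    half_energy_rate, which starts at the index 0. *)
Definition flip_mx r (A : 'M[R]_r) : 'M[R]_r :=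
  \matrix_(i, k) A (rev_ord i) (rev_ord k).

(** The derivative of the quadratic form at z = 0 is w^T A u + u^T A w, and the
    symmetry of A makes it twice the second term. *)
Lemma energy_quotient0 r (A : 'M[R]_r) N (a : nat -> R) :
  A^T = A -> (forall n, (N <= n)%N -> a n = 0) ->
  energy_quotient A N.+2 0 (extrap a) = 2 * half_energy_rate (flip_mx A) N a a.
Proof.
move=> symA aN.
rewrite /energy_quotient /half_energy_rate mulrDr; congr (_ + _).
  have rn n : - r%:Z - n%:Z = - (r + n)%N%:Z by lia.
  rewrite !big_ord_recr /= !rn !extrapN !aN ?leq_addl //; last first.
    by rewrite addnS ltnW // ltnS leq_addl.
  rewrite !mul0r !mulr0 !addr0 !mulr0 !addr0 mulr_sumr; apply: eq_bigr => n _.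
  by rewrite !rn extrapN rate0; ring.
set x := fun p : 'I_r => extrap a (- r%:Z + 1 + p%:Z).
set w := fun p : 'I_r => rate 0 (extrap a) (- r%:Z + 1 + p%:Z).
transitivity (\sum_(p < r) \sum_(q < r) A p q * (w p * x q)
  + \sum_(p < r) \sum_(q < r) A p q * (x p * w q)).
  rewrite -big_split /=; apply: eq_bigr => p _.
  by rewrite -big_split /=; apply: eq_bigr => q _; rewrite /w /x; ring.
have -> : \sum_(p < r) \sum_(q < r) A p q * (w p * x q)
  = \sum_(p < r) \sum_(q < r) A p q * (x p * w q).
  rewrite exchange_big /=; apply: eq_bigr => p _; apply: eq_bigr => q _.
  by rewrite -[in LHS]symA mxE; ring.
have dbl (y : R) : y + y = 2 * y by ring.
rewrite dbl; congr (2 * _).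
rewrite (reindex_inj rev_ord_inj) /=; apply: eq_bigr => i _.
rewrite (reindex_inj rev_ord_inj) /=; apply: eq_bigr => k _.
have rE (l : 'I_r) : - r%:Z + 1 + (rev_ord l)%:Z = - l%:Z.
  by rewrite /=; have := ltn_ord l; lia.
by rewrite /x /w !rE extrapN rate0 mxE mulrA.
Qed.

End small_time_step.

Theorem theorem2 (R : realType) :
  ~ (exists (z0 : R) (r : nat) (H : R -> 'M[R]_r),
      [/\ 0 < z0,
          {within `[0, z0], continuous H} &
          forall z : R, 0 <= z <= z0 ->
            (H z)^T = H z /\
            (forall Phi : int -> R,
               ell2_upto 2 Phi ->
               Delta Phi 1 = 0 -> Delta Phi 0 = 0 ->
               forall Psi : int -> R,
               (forall j : int, j <= 0 -> Psi j = scheme z Phi j) ->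
               (sqnorm_upto (- r%:Z)%R Psi
                + (quad_form (H z) (boundary_vec r Psi))%:E
                - sqnorm_upto (- r%:Z)%R Phi
                - (quad_form (H z) (boundary_vec r Phi))%:E <= 0)%E)]).
Proof.
case=> z0 [r [H [z0_gt0 Hcont Henergy]]].
have H0sym : (H 0)^T = H 0 by case: (Henergy 0) => //; rewrite lexx ltW.
have Hcvg p q : H z p q @[z --> 0^'+] --> H 0 p q.
  have : {within `[0, z0], continuous (fun z => H z p q)}.
    by move=> z; exact: (continuous_comp (Hcont z) (@coord_continuous _ _ _ p q (H z))).
  by case/(continuous_within_itvP _ z0_gt0).
apply: (@not_dissipative _ _ (flip_mx (H 0))).
  by apply/matrixP => i k; rewrite !mxE -[in LHS]H0sym mxE.
move=> a N aN; rewrite -(pmulr_rle0 _ (ltr0n _ 2)) -energy_quotient0 //.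
apply: (cvgr_to_le (cvg_energy_quotient (M := N.+2) (u := extrap a) Hcvg)).
near=> z.
have z_gt0 : 0 < z by near: z; exact: nbhs_right_gt.
have z_le : z <= z0 by near: z; exact: nbhs_right_le.
rewrite -(pmulr_rle0 _ z_gt0) -energy_quotientE -lee_fin.
have uN n : (N <= n)%N -> extrap a (- n%:Z) = 0 by rewrite extrapN; exact: aN.
have rn n : - r%:Z - n%:Z = - (r + n)%N%:Z by lia.
have zin : 0 <= z <= z0 by rewrite z_le ltW.
have ell2a : ell2_upto 2 (extrap a).
  rewrite /ell2_upto (@sqnorm_upto_fin _ _ _ N.+2) ?ltry // => n Nn.
  by rewrite (_ : 2 - n%:Z = - (n - 2)%N%:Z) ?uN //; lia.
have [_ /(_ _ ell2a (Delta_extrap1 a) (Delta_extrap0 a))] := Henergy z zin.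
move=> /(_ (scheme z (extrap a)) (fun _ _ => erefl)).
rewrite (@sqnorm_upto_fin _ _ _ N.+2) => [|n Nn]; last first.
  by rewrite rn (@scheme_fin_support _ _ _ N) //; lia.
rewrite (@sqnorm_upto_fin _ _ _ N.+2) => [|n Nn]; last by rewrite rn uN //; lia.
by rewrite !EFinB EFinD.
Unshelve. all: by end_near. Qed.
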